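(* Let $p$ be a prime. If $G$ is a finite $p$-group with $\mathrm{cod}(G)=\{1,p,p^b,p^a\}$ where $2\le b<a$, then the nilpotence class of $G$ is at most $a+1$.
   Context: For an irreducible complex character $\chi$ of a finite group $G$, the codegree of $\chi$ is $\mathrm{cod}(\chi)=|G:\ker\chi|/\chi(1)$, and $\mathrm{cod}(G)$ denotes the set of codegrees of the irreducible characters of $G$. *)

(* Defs.v *)
From mathcomp Require Import all_boot all_order all_algebra all_fingroup all_solvable all_field all_character.
Set Implicit Arguments. Unset Strict Implicit. Unset Printing Implicit Defensive.
Import GRing.Theory Num.Theory.
Local Open Scope ring_scope.

Definition codeg (gT : finGroupType) (G : {group gT}) (i : Iirr G) : algC :=
  (#|G : cfker 'chi[G]_i|%g)%:R / 'chi[G]_i 1%g.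

Definition in_cod (gT : finGroupType) (G : {group gT}) (x : algC) : Prop :=
  exists i : Iirr G, codeg i = x.

(* Main.v *)
(* A faithful character of codegree at most p^a bounds the order of a p-group Q
   by p^(2a-1), because chi(1) p <= cod(chi).  On the other hand a p-group with
   codegrees among 1, p, n has class at most 2; if Q has class at least 4, the
   class-3 group Q / L_4(Q) must therefore have a character of codegree p^a,
   whence |Q : L_4(Q)| >= p^(a+1) and |L_4(Q)| <= p^(a-2), which leaves room for
   at most a - 2 further steps of the lower central series. *)
Require Import Defs.
From mathcomp Require Import all_boot all_order all_algebra all_fingroup all_solvable all_field all_character.
From mathcomp Require Import zify.
Import GRing.Theory Num.Theory.
Local Open Scope ring_scope.

Section Codegree.

Set Implicit Arguments.
Unset Strict Implicit.

Local Open Scope nat_scope.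
Local Open Scope group_scope.

Implicit Types (gT : finGroupType) (p n k m : nat).

(** The first equation forces [d = m * e], after which [d * e] cancels. It serves below with [d],
    [e] the degrees of chi and psi, [z = |Z(G)|], [m = |M|], [q = |Y : M|]: both sides of the
    equation are then [|G|]. *)
Lemma leq_mul_cancel (z m d e q : nat) :
    (0 < d)%N -> (0 < e)%N -> (0 < q)%N ->
    (m * q * e ^ 2 = d * (e * q))%N -> (z * d ^ 2 <= d * (e * q))%N ->
  (z * m <= q)%N.
Proof.
move=> d0 e0 q0; rewrite -!mulnn => e1 e2.
have def_d : d = (m * e)%N.
  have : (d * (e * q) = m * e * (e * q))%N by rewrite -e1; lia.
  by move/eqP; rewrite eqn_pmul2r ?muln_gt0 ?e0 // => /eqP.
move: e2; rewrite mulnCA leq_pmul2l // def_d mulnA [(e * q)%N]mulnC.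
by rewrite leq_pmul2r.
Qed.

(** * Degrees, kernels and codegrees of irreducible characters *)

Definition deg gT (G : {group gT}) (i : Iirr G) : nat :=
  irr_degree (socle_of_Iirr i).

Lemma irr1_deg gT (G : {group gT}) (i : Iirr G) : 'chi_i 1%g = (deg i)%:R :> algC.
Proof. exact: irr1_degree. Qed.

Lemma deg_gt0 gT (G : {group gT}) (i : Iirr G) : 0 < deg i.
Proof. by rewrite -ltC_nat -irr1_deg irr1_gt0. Qed.

Lemma lin_irr_deg gT (G : {group gT}) (i : Iirr G) :
  ('chi_i \is a linear_char) = (deg i == 1%N).
Proof. by rewrite qualifE/= irr_char irr1_deg pnatr_eq1. Qed.

Lemma codeg_natE gT (G : {group gT}) (i : Iirr G) n :
  codeg i = n%:R -> #|G : cfker 'chi_i| = (deg i * n)%N.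
Proof.
rewrite /codeg irr1_deg => def_n.
have nz : (deg i)%:R != 0%R :> algC by rewrite pnatr_eq0 -lt0n deg_gt0.
by apply/eqP; rewrite -eqC_nat natrM -def_n mulrC divfK.
Qed.

(** Inflation changes neither the degree nor the index of the kernel. Hence codegree hypotheses pass
    to quotients. *)
Lemma codeg_mod gT (G N : {group gT}) (i : Iirr (G / N)) :
  N <| G -> codeg (mod_Iirr i) = codeg i.
Proof.
move=> nsNG; rewrite /codeg mod_IirrE // cfMod1 -(quotient_cfker_mod G _ nsNG).
rewrite index_quotient_eq ?cfker_sub ?normal_norm //.
exact: subset_trans (subsetIr _ _) (cfker_mod _ nsNG).
Qed.

Lemma deg2_le_index gT (G : {group gT}) (i : Iirr G) :
  (deg i ^ 2 <= #|G : 'Z('chi_i)%CF|)%N.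
Proof. by rewrite -leC_nat natrX -irr1_deg; case: (irr1_bound i). Qed.

(** By Frobenius reciprocity ['chi_i] is a constituent of a character induced from a linear
    character of [A]. *)
Lemma deg_index_abelian gT (G A : {group gT}) (i : Iirr G) :
  abelian A -> A \subset G -> (deg i <= #|G : A|)%N.
Proof.
move=> cAA sAG; rewrite -leC_nat -irr1_deg.
have [j] := neq0_has_constt (Res_irr_neq0 A i).
rewrite -constt_Ind_Res => /(char1_ge_constt (cfInd_char G (irr_char j))).
have /lin_char1 j1 : 'chi_j \is a linear_char by apply/char_abelianP.
by rewrite cfInd1 // j1 mulr1.
Qed.

(** Multiply chi(1)^2 <= |G : Z(chi)| by |Z(chi) : ker chi|, then cancel chi(1) against |G : ker
    chi| = chi(1) n. *)
Lemma deg_mul_center_le_codeg gT (G : {group gT}) (i : Iirr G) n :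
    codeg i = n%:R ->
  (deg i * #|('Z('chi_i)%CF : {set gT}) : cfker 'chi_i| <= n)%N.
Proof.
move=> /codeg_natE def_n; have := deg2_le_index i.
rewrite -(leq_pmul2r (indexg_gt0 'Z('chi_i)%CF (cfker 'chi_i))).
rewrite Lagrange_index ?cfcenter_sub ?normal_sub ?cfker_center_normal // def_n.
by rewrite expnS expn1 -mulnA leq_pmul2l ?deg_gt0.
Qed.

(** Z(chi) / ker chi is the centre of the nontrivial p-group G / ker chi, so p divides its order. *)
Lemma deg_mul_prime_le_codeg gT (G : {group gT}) p (i : Iirr G) n :
    prime p -> p.-group G -> ~~ (G \subset cfker 'chi_i) ->
  codeg i = n%:R -> (deg i * p <= n)%N.
Proof.
move=> p_pr pG nKG /deg_mul_center_le_codeg; apply: leq_trans.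
rewrite leq_pmul2l ?deg_gt0 // -card_quotient; last first.
  exact/normal_norm/cfker_center_normal.
rewrite cfcenter_eq_center; have pGK := quotient_pgroup (cfker 'chi_i) pG.
apply: dvdn_leq (cardG_gt0 _) _.
have [] := pgroup_pdiv (pgroupS (center_sub _) pGK); last by [].
rewrite (center_nil_eq1 (pgroup_nil pGK)).
by rewrite -subG1 quotient_sub1 // normal_norm // cfker_normal.
Qed.

Lemma nonlinear_codeg_gt gT (G : {group gT}) p (i : Iirr G) n :
    prime p -> p.-group G -> ~~ ('chi_i \is a linear_char) ->
  codeg i = n%:R -> (p < n)%N.
Proof.
move=> p_pr pG nlin cod_i.
have nKG: ~~ (G \subset cfker 'chi_i).
  apply: contra nlin => sGK; rewrite lin_irr_der1.
  by rewrite (subset_trans (der_sub _ _)).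
have := deg_mul_prime_le_codeg p_pr pG nKG cod_i.
rewrite lin_irr_deg in nlin; have := deg_gt0 i; have := prime_gt1 p_pr; nia.
Qed.

(* If g generates G modulo ker 'chi_j, then <g> 'Z(G) is an abelian subgroup of
   index smaller than |ker 'chi_j|. *)
Lemma deg_lt_card_cfker_lin gT (G : {group gT}) (i j : Iirr G) :
    'chi_j \is a linear_char -> cfker 'chi_j :&: 'Z(G) != 1 ->
  (deg i < #|cfker 'chi_j|)%N.
Proof.
set L := cfker 'chi_j => lin_j ntLZ.
have nsLG : L <| G := cfker_normal _.
have cycGL: cyclic (G / L).
  have <- : ('Z('chi_j)%CF = G); last exact: cfcenter_cyclic.
  apply/eqP; rewrite eqEsubset cfcenter_sub; apply/subsetP=> x Gx.
  by rewrite irr_cfcenterE // normC_lin_char // lin_char1.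
have [gb def_gb] := cyclicP cycGL.
have : gb \in G / L by rewrite def_gb cycle_id.
case/morphimP=> g Ng Gg def_g; pose A := (<[g]> <*> 'Z(G))%G.
have sgG : <[g]> \subset G by rewrite cycle_subG.
have sAG: A \subset G by rewrite join_subG sgG center_sub.
have cAA: abelian A.
  rewrite abelianY cycle_abelian center_abelian /= centsC.
  by rewrite (subset_trans sgG) // centsC subsetIr.
have defG : (L * A)%g = G.
  apply/eqP; rewrite eqEsubset mul_subG ?(normal_sub nsLG) //=.
  rewrite -quotientSK ?normal_norm // def_gb cycle_subG def_g mem_quotient //.
  by rewrite mem_gen // inE cycle_id.
apply: leq_ltn_trans (deg_index_abelian i cAA sAG) _.
(* Since [L * A = G], the index of [A] is |L| / |L :&: A|, and [L :&: A] contains the nontrivial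
   [L :&: 'Z(G)]. *)
have /eqP := mul_cardG L A.
rewrite defG -(Lagrange sAG) mulnC -mulnA eqn_pmul2l ?cardG_gt0 // => /eqP->.
have: (1 < #|L :&: A|)%N.
  rewrite cardG_gt1; apply: contraNneq ntLZ => LA1.
  by rewrite -subG1 -LA1 setIS ?joing_subr.
by move/ltn_Pmulr; apply; apply: indexg_gt0.
Qed.

(** * Powers of elements and the derived subgroup *)

Lemma expg_index_normal gT (G H : {group gT}) x :
  H <| G -> x \in G -> x ^+ #|G : H| \in H.
Proof.
move=> nsHG Gx; have nHx := subsetP (normal_norm nsHG) x Gx.
apply: coset_idr; first exact: groupX.
by rewrite morphX //= -card_quotient ?normal_norm // expg_cardG ?mem_quotient.
Qed.

(** As u^p and [u, v] are central, [u, v]^p = [u^p, v] = 1. So the generators of G' lie in the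
    p-torsion of the abelian group Z(G), which is a subgroup, and x^p lies in G'. *)
Lemma class2_expg_p2 gT (G : {group gT}) p x :
    G^`(1) \subset 'Z(G) -> {in G, forall y, y ^+ p \in G^`(1)} ->
  x \in G -> x ^+ (p ^ 2) = 1.
Proof.
move=> sG'Z Gp Gx.
have cZ u v : u \in 'Z(G) -> v \in G -> commute u v.
  by move=> /centerP[_ cu] /cu.
have grpL : group_set 'Ldiv_p('Z(G)) by apply: group_Ldiv (center_abelian G).
suffices: G^`(1) \subset Group grpL.
  by move/subsetP/(_ _ (Gp x Gx)); rewrite !inE -expgM => /andP[_ /eqP].
rewrite gen_subG; apply/subsetP=> _ /imset2P[u v Gu Gv ->].
have Zuv: [~ u, v] \in 'Z(G) by rewrite (subsetP sG'Z) ?mem_commg.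
apply/LdivP; split=> //; rewrite -commXg; last exact/commute_sym/cZ.
by apply/eqP/commgP/cZ; rewrite ?(subsetP sG'Z) ?Gp.
Qed.

(** G' is the intersection of the kernels of the linear characters, so it suffices that each has
    codegree 1 or p. One of codegree n would have a kernel of order |G| / n = chi(1) for the
    faithful chi, against [deg_lt_card_cfker_lin]; its kernel meets the centre because it contains
    G' != 1. *)
Lemma expg_p_der1 gT (G : {group gT}) p n (i : Iirr G) x :
    p.-group G -> ~~ abelian G -> cfaithful 'chi_i -> codeg i = n%:R ->
    (forall j : Iirr G, [\/ codeg j = 1%R, codeg j = p%:R | codeg j = n%:R]) ->
  x \in G -> x ^+ p \in G^`(1).
Proof.
move=> pG nabG ker1 cod_i codG Gx.
rewrite -cap_cfker_lin_irr; apply/bigcapP=> j lin_j.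
have nsKG := cfker_normal 'chi_j.
have deg1: deg j = 1%N by apply/eqP; rewrite -lin_irr_deg.
case: (codG j) => cod_j.
- have := @codeg_natE _ _ _ 1 cod_j; rewrite deg1 => iK.
  by rewrite groupX // -[x]expg1 -[1%N]iK expg_index_normal.
- have := codeg_natE cod_j; rewrite deg1 mul1n => iK.
  by rewrite -[p]iK expg_index_normal.
have := codeg_natE cod_j; rewrite deg1 mul1n => iL.
have oL: #|cfker 'chi_j| = deg i.
  have := codeg_natE cod_i; rewrite (trivgP ker1) indexg1.
  rewrite -(Lagrange (normal_sub nsKG)) iL; move/eqP.
  have n_gt0 : 0 < n by rewrite -iL indexg_gt0.
  by rewrite eqn_pmul2r // => /eqP.
suff: deg i < #|cfker 'chi_j| by rewrite oL ltnn.
apply: deg_lt_card_cfker_lin => //; rewrite meet_center_nil ?(pgroup_nil pG) //.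
apply: contraNneq nabG => K1; apply/derG1P/trivgP; rewrite -K1.
by rewrite -lin_irr_der1.
Qed.

(** * Class at most 2 when the codegrees are among 1, p and n *)

Lemma quotient_lcn k gT (G H : {group gT}) :
  G \subset 'N(H) -> 'L_k(G) / H = 'L_k(G / H).
Proof. exact: morphim_lcn. Qed.

(* In a counterexample of least order, L_3(G) lies in a central subgroup N of
   order p, and there is a faithful irreducible chi.  Take psi nonlinear with
   N <= M = ker psi and put Y = Z(psi).  Then G / M has class 2, psi is fully
   ramified over Y, and cod(chi) = cod(psi) gives |Z(G)| |M| <= |Y : M|, while
   Y / M is cyclic of exponent dividing p^2.  So M = N = Z(G), |Y : M| = p^2, and
   a generator y of Y modulo M has [y^p, g] = [y, g]^p = 1 for all g, forcing
   y^p into Z(G) = M: a contradiction. *)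
Lemma nil_class_le2 gT (G : {group gT}) p n :
    prime p -> p.-group G ->
    (forall j : Iirr G, [\/ codeg j = 1%R, codeg j = p%:R | codeg j = n%:R]) ->
  nil_class G <= 2.
Proof.
move=> p_pr; have [m] := ubnP #|G|; elim: m gT G => // m IHm gT G leGm pG codG.
have nilG := pgroup_nil pG; have p_gt1 := prime_gt1 p_pr.
apply: contraT => cl3; have {cl3} ntL3: ~~ ('L_3(G) \subset [1 gT]).
  by apply: contra cl3 => /trivgP L3; apply/(lcn_nil_classP 2 nilG).
(* Minimality of [|G|]: quotients by nontrivial normal subgroups have class at most 2. A character
   whose kernel misses ['L_3(G)] is therefore faithful. *)
have L3min (H : {group gT}) : H <| G -> H :!=: 1 -> 'L_3(G) \subset H.
  move=> nsHG ntH; have nHG := normal_norm nsHG.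
  have /IHm/(_ (quotient_pgroup H pG)) cl2: #|G / H| < m.
    by apply: leq_trans (ltn_quotient ntH (normal_sub nsHG)) _.
  have /(lcn_nil_classP 2 (quotient_nil H nilG)) : nil_class (G / H) <= 2.
    by apply: cl2 => j; rewrite -codeg_mod.
  rewrite -quotient_lcn // => L3H.
  by rewrite -quotient_sub1 ?(subset_trans (lcn_sub 3 G)) // L3H.
have [i nKi]: exists i : Iirr G, ~~ ('L_3(G) \subset cfker 'chi_i).
  apply/existsP; apply: contraR ntL3; rewrite negb_exists => /forallP sL3.
  by rewrite -(TI_cfker_irr G); apply/bigcapsP=> i _; have := sL3 i; rewrite negbK.
have ker1: cfker 'chi_i = 1.
  by apply: contraNeq nKi => ntK; apply: L3min => //; apply: cfker_normal.
have ffi: cfaithful 'chi_i by rewrite /cfaithful ker1.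
have nabG: ~~ abelian G.
  apply: contra ntL3 => /derG1P G'1; rewrite lcnSn lcn2 G'1 comm1G; apply: subxx.
have nl_cod (j : Iirr G) : ~~ (G^`(1) \subset cfker 'chi_j) -> codeg j = n%:R.
  rewrite -lin_irr_der1 => nlin; case: (codG j) => // cod_j.
    have := @nonlinear_codeg_gt _ _ _ _ 1 p_pr pG nlin cod_j.
    by rewrite ltnS leqNgt prime_gt0.
  by have := nonlinear_codeg_gt p_pr pG nlin cod_j; rewrite ltnn.
have ntZ : 'Z(G) != 1.
  by rewrite center_nil_eq1 //; apply: contraNneq nabG => ->; apply: abelian1.
have pZ : p.-group 'Z(G) := pgroupS (center_sub G) pG.
have [_ pdZ _] := pgroup_pdiv pZ ntZ.
have [x Zx ox] := Cauchy p_pr pdZ.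
have sNZ: <[x]> \subset 'Z(G) by rewrite cycle_subG.
have nsNG: <[x]> <| G := sub_center_normal sNZ.
have sL3N: 'L_3(G) \subset <[x]>.
  by apply: L3min; rewrite // -cardG_gt1 -orderE ox.
have nsG'N: ~~ (G^`(1) \subset <[x]>).
  apply: contra ntL3 => sG'N; rewrite lcnSn lcn2; apply/trivgP/commG1P.
  exact: subset_trans sG'N (subset_trans sNZ (subsetIr _ _)).
(* [<[x]>] is the intersection of the irreducible kernels containing it, and it does not contain
   G'. *)
have [j sNM nG'M]: exists2 j : Iirr G, <[x]> \subset cfker 'chi_j
                               & ~~ (G^`(1) \subset cfker 'chi_j).
  apply/exists_inP; apply: contraR nsG'N; rewrite negb_exists_in => /forall_inP sG'.
  rewrite -(cap_cfker_normal nsNG); apply/bigcapsP=> j sNj.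
  by have := sG' j sNj; rewrite negbK.
have cod_i: codeg i = n%:R.
  by apply: nl_cod; rewrite ker1; apply: contra nabG => /trivgP/derG1P.
have cod_j := nl_cod j nG'M.
have Gp := expg_p_der1 pG nabG ffi cod_i codG.
set M := cfker 'chi_j in sNM nG'M; pose Y := 'Z('chi_j)%CF.
have nsMG : M <| G := cfker_normal _; have nMG := normal_norm nsMG.
have nsMY : M <| Y := cfker_center_normal _.
have sYG : Y \subset G := cfcenter_sub _.
have YM : Y / M = 'Z(G / M) := cfcenter_eq_center j.
have sG'Y : G^`(1) \subset Y.
  rewrite -(quotientSGK _ (normal_sub nsMY)) ?(subset_trans (der_sub 1 G)) //.
  rewrite YM subsetI quotientS ?der_sub //= quotient_cents2r //.
  exact: subset_trans sL3N sNM.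
(* [G / Y] is abelian, so the bound psi(1)^2 <= |G : Y| is attained. *)
have deg_j : (deg j ^ 2 = #|G : Y|)%N.
  apply/eqP; rewrite -eqC_nat natrX -irr1_deg irr1_abelian_bound //.
  exact: sub_der1_abelian.
have deg_i : (deg i ^ 2 <= #|G : 'Z(G)|)%N.
  by have := deg2_le_index i; rewrite cfcenter_fful_irr.
have n_def : n = (deg j * #|Y : M|)%N.
  have /eqP := codeg_natE cod_j; rewrite -/M -(Lagrange_index sYG (normal_sub nsMY)).
  by rewrite -deg_j expnS expn1 -mulnA eqn_pmul2l ?deg_gt0 // => /eqP.
have oG : #|G| = (deg i * n)%N.
  by have := codeg_natE cod_i; rewrite ker1 indexg1.
have le_ZM : (#|'Z(G)| * #|M| <= #|Y : M|)%N.
  apply: (leq_mul_cancel (deg_gt0 i) (deg_gt0 j) (indexg_gt0 Y M)).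
    by rewrite deg_j Lagrange ?normal_sub // Lagrange // oG n_def.
  rewrite -n_def -oG -(Lagrange (center_sub G)).
  by rewrite leq_pmul2l.
have cycYM : cyclic (Y / M) := cfcenter_cyclic _.
have [yb def_yb] := cyclicP cycYM.
have : yb \in Y / M by rewrite def_yb cycle_id.
case/morphimP=> y Ny Yy /= def_y.
have Gy := subsetP sYG y Yy.
have iYM : #|Y : M| = #[yb] by rewrite -card_quotient ?normal_norm // def_yb.
have le_p2 : (#|Y : M| <= p ^ 2)%N.
  rewrite iYM; apply: dvdn_leq; first by rewrite expn_gt0 prime_gt0.
  rewrite order_dvdn; apply/eqP; apply: (@class2_expg_p2 _ (G / M)).
  - by rewrite -quotient_der // -YM quotientS.
  - move=> _ /morphimP[z Nz Gz ->]; rewrite -quotient_der //= -morphX //.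
    by rewrite mem_quotient // Gp.
  by rewrite def_y mem_quotient.
have leNM := subset_leq_card sNM; have leNZ := subset_leq_card sNZ.
rewrite -!orderE ox in leNM leNZ.
have [[oM oZ] iYMp] : (#|M| = p /\ #|'Z(G)| = p) /\ #|Y : M| = (p * p)%N.
  move: le_ZM le_p2 leNM leNZ p_gt1; rewrite -mulnn; clear.
  move: #|M| #|_| #|_ : _| => u v w; nia.
have eqMN : <[x]> = M by apply/eqP; rewrite eqEcard sNM -orderE ox oM /=.
have eqZN : <[x]> = 'Z(G) by apply/eqP; rewrite eqEcard sNZ -orderE ox oZ /=.
have Zyp : y ^+ p \in 'Z(G).
  apply/centerP; split=> [|g Gg]; first exact: groupX.
  have Myg : [~ y, g] \in M.
    have: [~: Y, G] \subset M.
      by rewrite -quotient_cents2 ?(subset_trans sYG) // YM subsetIr.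
    by move/subsetP; apply; apply: mem_commg.
  have Zyg : [~ y, g] \in 'Z(G) by rewrite -eqZN eqMN.
  apply/commgP; rewrite commXg; last first.
    by have /centerP[_ /(_ y Gy)/commute_sym] := Zyg.
  by rewrite -order_dvdn -oM order_dvdG.
move: Zyp; rewrite -eqZN eqMN => /coset_id; rewrite morphX //= -def_y => yp.
have : #[yb] %| p by rewrite order_dvdn yp.
by move/(dvdn_leq (prime_gt0 p_pr)); rewrite -iYM iYMp leqNgt ltn_Pmulr ?prime_gt0.
Qed.

(** * Orders along the lower central series *)

Lemma lcn_properS gT (G : {group gT}) k :
  nilpotent G -> 'L_k.+1(G) :!=: 1 -> 'L_k.+2(G) \proper 'L_k.+1(G).
Proof.
move=> nilG ntL; rewrite lcnSn (nil_comm_properl nilG) ?lcn_sub //.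
by rewrite subsetI subxx lcn_norm.
Qed.

(** As long as the series has not reached 1 each step is strict, hence divides the order by at least
    p; here there are [m] steps. *)
Lemma card_lcn_ge gT (G : {group gT}) p k m :
    prime p -> p.-group G -> 'L_(m + k.+1)(G) :!=: 1 ->
  (p ^ m * #|'L_(m + k.+1)(G)| <= #|'L_k.+1(G)|)%N.
Proof.
move=> p_pr pG; elim: m => [|m IHm]; first by rewrite mul1n.
rewrite addSn addnS in IHm * => ntA.
have sAB : 'L_(m + k).+2(G) \subset 'L_(m + k).+1(G) by apply: lcn_subS.
have ntB : 'L_(m + k).+1(G) :!=: 1.
  by apply: contraNneq ntA => B1; rewrite -subG1 -B1.
apply: leq_trans (IHm ntB); rewrite expnS [(p * _)%N]mulnC -mulnA leq_pmul2l.
  rewrite -(Lagrange sAB) mulnC leq_pmul2l ?cardG_gt0 //.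
  have pL : p.-group 'L_(m + k).+1(G) := pgroupS (lcn_sub _ _) pG.
  have /andP[_] := lcn_properS (pgroup_nil pG) ntB.
  rewrite -indexg_gt1 => idx_gt1; apply: dvdn_leq => //.
  have /p_natP[e def_e] := pnat_dvd (dvdn_indexg _ 'L_(m + k).+2(G)) pL.
  by move: idx_gt1; rewrite def_e; case: e {def_e} => // e _; rewrite expnS dvdn_mulr.
by rewrite expn_gt0 prime_gt0.
Qed.

(** H = G / L_4(G) has class exceeding 2, so by [nil_class_le2] the codegrees 1, p, n1 cannot
    suffice and some psi has codegree n2. Then |H| = |ker psi| psi(1) n2, and equality with n2 would
    make psi linear and faithful, hence H abelian. *)
Lemma codeg_lt_card_quotient_lcn4 gT (G : {group gT}) p n1 n2 :
    prime p -> p.-group G -> 'L_4(G) :!=: 1 ->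
    (forall j : Iirr G, [\/ codeg j = 1%R, codeg j = p%:R,
                            codeg j = n1%:R | codeg j = n2%:R]) ->
  n2 < #|G / 'L_4(G)|.
Proof.
move=> p_pr pG ntL4 codG; have nilG := pgroup_nil pG.
have nsL4 : 'L_4(G) <| G := lcn_normal 4 G.
pose H := (G / 'L_4(G))%G; have nL4 := normal_norm nsL4.
have pH : p.-group H := quotient_pgroup _ pG.
have clH : ~~ (nil_class H <= 2).
  apply/negP => /(lcn_nil_classP 2 (pgroup_nil pH)) L31.
  have: 'L_3(G) \subset 'L_4(G).
    rewrite -quotient_sub1 ?(subset_trans (lcn_sub _ _)) //.
    by rewrite quotient_lcn // L31.
  have ntL3 : 'L_3(G) :!=: 1.
    by apply: contraNneq ntL4 => L3; rewrite -subG1 -L3 lcn_subS.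
  by have /andP[_ /negP] := lcn_properS nilG ntL3.
have nabH : ~~ abelian H.
  by apply: contra clH; rewrite -nil_class1 => /leqW.
have /existsP[j /eqP cod_j] : [exists j : Iirr H, codeg j == n2%:R].
  apply: contraR clH; rewrite negb_exists => /forallP codH'.
  apply: (@nil_class_le2 _ _ p n1) => // j.
  have := codG (mod_Iirr j); rewrite codeg_mod // => -[||| cod_j]; try by constructor.
  by have := codH' j; rewrite cod_j eqxx.
rewrite -(Lagrange (cfker_sub 'chi_j)) (codeg_natE cod_j).
have [n0 | n_gt0] := posnP n2.
  by have := indexg_gt0 H (cfker 'chi_j); rewrite (codeg_natE cod_j) n0 muln0.
rewrite mulnA ltn_Pmull //.
have [lin_j | ] := boolP ('chi_j \is a linear_char); last first.
  rewrite lin_irr_deg => deg_j; apply: leq_trans (leq_pmull _ (cardG_gt0 _)).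
  by rewrite ltn_neqAle eq_sym deg_j deg_gt0.
apply: leq_trans (leq_pmulr _ (deg_gt0 j)); rewrite cardG_gt1.
apply: contraNneq nabH => K1; apply/derG1P/trivgP; rewrite -K1.
by rewrite -lin_irr_der1.
Qed.

End Codegree.

(** * The bound on the class *)

Theorem theorem1p4 (gT : finGroupType) (G : {group gT}) (p a b : nat) :
  prime p -> (p.-group G)%g ->
  (2 <= b)%N -> (b < a)%N ->
  (forall x : algC, in_cod G x <->
     x = 1 \/ x = p%:R \/ x = (p ^ b)%:R \/ x = (p ^ a)%:R) ->
  (nil_class G <= a.+1)%N.
Proof.
move=> p_pr pG b_gt1 lt_ba codG.
have p_gt0 := prime_gt0 p_pr; have p_gt1 := prime_gt1 p_pr.
have nilG := pgroup_nil pG.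
apply: contraT => cl.
(* Class above a + 1 means L_(a+2)(G) != 1, and the irreducible kernels intersect trivially. The
   quotient Q by the kernel found here still has L_(a+2)(Q) != 1. *)
have {cl} [i nKi]: exists i : Iirr G, ~~ ('L_a.+2(G) \subset cfker 'chi_i)%g.
  apply/existsP; apply: contraR cl; rewrite negb_exists => /forallP sL.
  apply/(lcn_nil_classP a.+1 nilG)/trivgP.
  by rewrite -(TI_cfker_irr G); apply/bigcapsP=> i _; have := sL i; rewrite negbK.
pose K := cfker_group 'chi_i; have nsKG : (K <| G)%g := cfker_normal _.
have nKG := normal_norm nsKG.
have [c c_le cod_i]: exists2 c, (c <= p ^ a)%N & codeg i = c%:R.
  have /codG [->|[->|[->|->]]] : in_cod G (codeg i) by exists i.
  - by exists 1%N; rewrite // expn_gt0 p_gt0.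
  - by exists p; rewrite // -{1}[p]expn1 leq_exp2l //; lia.
  - by exists (p ^ b)%N; rewrite // leq_exp2l // ltnW.
  by exists (p ^ a)%N.
have deg_p_c : (deg i * p <= c)%N.
  apply: (deg_mul_prime_le_codeg p_pr pG _ cod_i).
  by apply: contra nKi; apply: subset_trans (lcn_sub _ _).
have oQ : #|(G / K)%g| = (deg i * c)%N.
  by rewrite card_quotient // (codeg_natE cod_i).
have pQ : (p.-group (G / K))%g := quotient_pgroup K pG.
(* The index is written so as to count a - 2 steps down from L_4; the subtraction is not truncated
   since a >= 3. *)
have ntL : ('L_(a - 2 + 4)(G / K) != 1)%g.
  have -> : (a - 2 + 4 = a.+2)%N by lia.
  by rewrite -quotient_lcn // -subG1 quotient_sub1 // (subset_trans (lcn_sub _ _)).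
have ntL4 : ('L_4(G / K) != 1)%g.
  by apply: contraNneq ntL => L4; rewrite -subG1 -L4 lcn_sub_leq // leq_addl.
have ltaH : (p ^ a < #|(G / K / 'L_4(G / K))%g|)%N.
  apply: (@codeg_lt_card_quotient_lcn4 _ _ p (p ^ b) (p ^ a)) => // j.
  rewrite -(codeg_mod j nsKG).
  have /codG [->|[->|[->|->]]] : in_cod G (codeg (mod_Iirr j)) by exists (mod_Iirr j).
  - by constructor.
  - by constructor.
  - by constructor.
  by constructor.
(* A power of p exceeding p^a is at least p^(a+1). *)
have lbH : (p ^ a.+1 <= #|(G / K / 'L_4(G / K))%g|)%N.
  have /p_natP[e oH] : p.-nat #|(G / K / 'L_4(G / K))%g| by apply: quotient_pgroup.
  by move: ltaH; rewrite oH // ltn_exp2l // leq_exp2l.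
(* The a - 2 steps give p^(a-2), and the nontrivial last term L_(a+2) one more factor p. *)
have lbL4 : (p ^ a.-1 <= #|('L_4(G / K))%g|)%N.
  apply: leq_trans (card_lcn_ge p_pr pQ ntL).
  have -> : a.-1 = (a - 2).+1 by lia.
  rewrite expnSr leq_pmul2l ?expn_gt0 ?p_gt0 //; apply: dvdn_leq => //.
  by have [] := pgroup_pdiv (pgroupS (lcn_sub _ _) pQ) ntL.
have oL4 : (#|'L_4(G / K)%g| * #|(G / K / 'L_4(G / K))%g| = deg i * c)%N.
  by rewrite -oQ [in LHS]card_quotient ?lcn_norm // Lagrange ?lcn_sub.
have pa_gt0 : (0 < p ^ a)%N by rewrite expn_gt0 p_gt0.
have lb : (p ^ a * p ^ a <= deg i * c)%N.
  rewrite -oL4; apply: leq_trans (leq_mul lbL4 lbH).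
  by rewrite -!expnD leq_exp2l //; lia.
have ub : (deg i * p * c <= p ^ a * p ^ a)%N.
  by apply: leq_mul => //; apply: leq_trans deg_p_c _.
have c_gt0 : (0 < deg i * c)%N by rewrite -oQ.
(* With |Q| = chi(1) c, the two bounds read p |Q| <= p^(2a) <= |Q|, which is absurd. *)
have := leq_trans ub lb; rewrite -mulnA mulnCA -[X in (_ <= X)%N]mul1n.
by rewrite leq_pmul2r // leqNgt p_gt1.
Qed.
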